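(* Let $\mathbb{T} = \{z \in \mathbb{C} : |z| = 1\}$ and let $U \neq \emptyset$ be a finite union of finite subgroups of $\mathbb{T}$. Then there exists an irreducible stochastic operator $T$ on $\ell^1$ whose peripheral spectrum equals $U$.
   Context: $\ell^1$ is the complex Banach lattice of absolutely summable complex sequences. A bounded linear operator $T$ on $\ell^1$ is called stochastic if for each $0 \le f \in \ell^1$ we have $Tf \ge 0$ and $\|Tf\| = \|f\|$ (such an operator has spectral radius $1$). A positive operator $T$ on a complex Banach lattice $E$ is called irreducible if $T$ does not leave any closed (lattice) ideal of $E$ invariant except for $\{0\}$ and $E$. The peripheral spectrum of an operator $T$ with spectral radius $1$ is the set of all spectral values of $T$ of modulus $1$, i.e. $\sigma(T) \cap \mathbb{T}$. *)

(* Defs.v *)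
From Stdlib Require Import Reals Lra List ProofIrrelevance FunctionalExtensionality.
From Coquelicot Require Import Coquelicot.

Set Implicit Arguments.
Unset Strict Implicit.
Open Scope R_scope.

Record l1 : Type := mk_l1 {
  l1_seq :> nat -> C;
  l1_summable : ex_series (fun n => Cmod (l1_seq n))
}.

Lemma l1_ext (f g : l1) : (forall n, f n = g n) -> f = g.
Proof.
destruct f as [f Hf], g as [g Hg]; simpl; intros E.
assert (f = g) as <- by (apply functional_extensionality, E).
f_equal; apply proof_irrelevance.
Qed.

Lemma summable_dominated (a : nat -> C) (b : nat -> R) :
  (forall n, Cmod (a n) <= b n) -> ex_series b ->
  ex_series (fun n => Cmod (a n)).
Proof.
intros H Hb; apply (@ex_series_le R_AbsRing R_CompleteNormedModule _ b); auto.
intros n; change (Rabs (Cmod (a n)) <= b n).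
rewrite Rabs_pos_eq; [apply H | apply Cmod_ge_0].
Qed.

Lemma summable_plus (f g : l1) :
  ex_series (fun n => Cmod (f n + g n)%C).
Proof.
apply summable_dominated with (b := fun n => Cmod (f n) + Cmod (g n)).
- intros n; apply Cmod_triangle.
- apply (@ex_series_plus R_AbsRing R_NormedModule); apply l1_summable.
Qed.

Lemma summable_opp (f : l1) : ex_series (fun n => Cmod (- f n)%C).
Proof.
apply ex_series_ext with (2 := l1_summable f).
intros n; symmetry; apply Cmod_opp.
Qed.

Lemma summable_zero : ex_series (fun _ : nat => Cmod 0).
Proof.
exists 0; apply is_series_Reals; intros eps Heps.
exists 0%nat; intros n _.
rewrite Cmod_0, sum_eq_R0 by reflexivity.
now rewrite R_dist_eq.
Qed.

Lemma summable_scal (c : C) (f : l1) :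
  ex_series (fun n => Cmod (c * f n)%C).
Proof.
apply ex_series_ext with (fun n => Cmod c * Cmod (f n)).
- intros n; symmetry; apply Cmod_mult.
- apply (@ex_series_scal R_AbsRing R_NormedModule (Cmod c)); apply l1_summable.
Qed.

Definition l1_plus (f g : l1) : l1 := mk_l1 (summable_plus f g).
Definition l1_opp (f : l1) : l1 := mk_l1 (summable_opp f).
Definition l1_zero : l1 := mk_l1 summable_zero.
Definition l1_scal (c : C) (f : l1) : l1 := mk_l1 (summable_scal c f).
Definition l1_norm (f : l1) : R := Series (fun n => Cmod (f n)).
Definition l1_ball (f : l1) (e : R) (g : l1) : Prop :=
  l1_norm (l1_plus g (l1_opp f)) < e.

Lemma l1_norm_triangle (f g : l1) :
  l1_norm (l1_plus f g) <= l1_norm f + l1_norm g.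
Proof.
unfold l1_norm; rewrite <- Series_plus by apply l1_summable.
apply Series_le.
- intros n; split; [apply Cmod_ge_0 | apply Cmod_triangle].
- apply (@ex_series_plus R_AbsRing R_NormedModule); apply l1_summable.
Qed.

Lemma l1_norm_scal (c : C) (f : l1) :
  l1_norm (l1_scal c f) = Cmod c * l1_norm f.
Proof.
unfold l1_norm; rewrite <- Series_scal_l.
apply Series_ext; intros n; apply Cmod_mult.
Qed.

Lemma l1_norm_opp (f : l1) : l1_norm (l1_opp f) = l1_norm f.
Proof. apply Series_ext; intros n; apply Cmod_opp. Qed.

Lemma l1_norm_zero : l1_norm l1_zero = 0.
Proof.
apply is_series_unique, is_series_Reals; intros eps Heps.
exists 0%nat; intros n _.
rewrite sum_eq_R0 by (intros; apply Cmod_0).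
now rewrite R_dist_eq.
Qed.

Lemma Cmod_le_l1_norm (f : l1) (n : nat) : Cmod (f n) <= l1_norm f.
Proof.
unfold l1_norm.
rewrite (Series_incr_n _ (S n)); [| apply Nat.lt_0_succ | apply l1_summable].
assert (0 <= Series (fun k => Cmod (f (S n + k)%nat))) as H1.
{ rewrite <- (Rmult_0_l (Series (fun k => Cmod (f (S n + k)%nat)))).
  rewrite <- Series_scal_l.
  apply Series_le; [intros k; rewrite Rmult_0_l; split; [lra | apply Cmod_ge_0] |].
  apply (ex_series_incr_n (fun k => Cmod (f k))), l1_summable. }
assert (Cmod (f n) <= sum_f_R0 (fun k => Cmod (f k)) n) as H2.
{ destruct n as [|n]; simpl; [lra |].
  assert (0 <= sum_f_R0 (fun k => Cmod (f k)) n)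
    by (apply cond_pos_sum; intros; apply Cmod_ge_0).
  lra. }
simpl pred; lra.
Qed.

Lemma l1_norm_eq_zero (f : l1) : l1_norm f = 0 -> f = l1_zero.
Proof.
intros H; apply l1_ext; intros n; apply Cmod_eq_0.
apply Rle_antisym; [rewrite <- H; apply Cmod_le_l1_norm | apply Cmod_ge_0].
Qed.

Lemma l1_plus_comm (f g : l1) : l1_plus f g = l1_plus g f.
Proof. apply l1_ext; intros n; apply Cplus_comm. Qed.

Lemma l1_plus_assoc (f g h : l1) :
  l1_plus f (l1_plus g h) = l1_plus (l1_plus f g) h.
Proof. apply l1_ext; intros n; apply Cplus_assoc. Qed.

Lemma l1_plus_zero_r (f : l1) : l1_plus f l1_zero = f.
Proof. apply l1_ext; intros n; apply Cplus_0_r. Qed.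

Lemma l1_plus_opp_r (f : l1) : l1_plus f (l1_opp f) = l1_zero.
Proof. apply l1_ext; intros n; apply Cplus_opp_r. Qed.

Definition l1_AbelianMonoid_mixin :=
  AbelianMonoid.Mixin l1 l1_plus l1_zero
    l1_plus_comm l1_plus_assoc l1_plus_zero_r.
Canonical l1_AbelianMonoid := AbelianMonoid.Pack l1 l1_AbelianMonoid_mixin l1.

Definition l1_AbelianGroup_mixin :=
  AbelianGroup.Mixin l1_AbelianMonoid l1_opp l1_plus_opp_r.
Canonical l1_AbelianGroup :=
  AbelianGroup.Pack l1
    (AbelianGroup.Class _ l1_AbelianMonoid_mixin l1_AbelianGroup_mixin) l1.

Lemma l1_scal_assoc (a b : C) (f : l1) :
  l1_scal a (l1_scal b f) = l1_scal (a * b)%C f.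
Proof. apply l1_ext; intros n; apply Cmult_assoc. Qed.

Lemma l1_scal_one (f : l1) : l1_scal 1%C f = f.
Proof. apply l1_ext; intros n; apply Cmult_1_l. Qed.

Lemma l1_scal_distr_l (a : C) (f g : l1) :
  l1_scal a (l1_plus f g) = l1_plus (l1_scal a f) (l1_scal a g).
Proof. apply l1_ext; intros n; apply Cmult_plus_distr_l. Qed.

Lemma l1_scal_distr_r (a b : C) (f : l1) :
  l1_scal (a + b)%C f = l1_plus (l1_scal a f) (l1_scal b f).
Proof. apply l1_ext; intros n; apply Cmult_plus_distr_r. Qed.

Definition l1_ModuleSpace_mixin :=
  ModuleSpace.Mixin C_Ring l1_AbelianGroup l1_scal
    l1_scal_assoc l1_scal_one l1_scal_distr_l l1_scal_distr_r.
Canonical l1_ModuleSpace :=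
  ModuleSpace.Pack C_Ring l1
    (ModuleSpace.Class _ _ (AbelianGroup.class l1_AbelianGroup)
       l1_ModuleSpace_mixin) l1.

Lemma l1_ball_center (f : l1) (e : posreal) : l1_ball f e f.
Proof.
unfold l1_ball; rewrite l1_plus_opp_r, l1_norm_zero; apply cond_pos.
Qed.

Lemma l1_ball_sym (f g : l1) (e : R) : l1_ball f e g -> l1_ball g e f.
Proof.
unfold l1_ball; intros H; rewrite <- l1_norm_opp.
replace (l1_opp (l1_plus f (l1_opp g))) with (l1_plus g (l1_opp f)); auto.
apply l1_ext; intros n; simpl; ring.
Qed.

Lemma l1_ball_triangle (f g h : l1) (e1 e2 : R) :
  l1_ball f e1 g -> l1_ball g e2 h -> l1_ball f (e1 + e2) h.
Proof.
unfold l1_ball; intros H1 H2.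
replace (l1_plus h (l1_opp f))
  with (l1_plus (l1_plus h (l1_opp g)) (l1_plus g (l1_opp f))).
- apply Rle_lt_trans with (1 := l1_norm_triangle _ _); lra.
- apply l1_ext; intros n; simpl; ring.
Qed.

Definition l1_UniformSpace_mixin :=
  UniformSpace.Mixin l1 l1_zero l1_ball
    l1_ball_center l1_ball_sym l1_ball_triangle.
Canonical l1_UniformSpace := UniformSpace.Pack l1 l1_UniformSpace_mixin l1.

Canonical l1_NormedModuleAux :=
  NormedModuleAux.Pack C_AbsRing l1
    (NormedModuleAux.Class C_AbsRing l1
       (ModuleSpace.class C_Ring l1_ModuleSpace)
       (UniformSpace.class l1_UniformSpace)) l1.

Lemma l1_norm_scal_le (c : C_AbsRing) (f : l1) :
  l1_norm (l1_scal c f) <= abs c * l1_norm f.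
Proof. rewrite l1_norm_scal; apply Rle_refl. Qed.

Lemma l1_norm_compat1 (f g : l1) (e : R) :
  l1_norm (l1_plus g (l1_opp f)) < e -> l1_ball f e g.
Proof. auto. Qed.

Lemma l1_norm_compat2 (f g : l1) (e : posreal) :
  l1_ball f e g -> l1_norm (l1_plus g (l1_opp f)) < 1 * e.
Proof. rewrite Rmult_1_l; auto. Qed.

Definition l1_NormedModule_mixin :=
  NormedModule.Mixin C_AbsRing l1_NormedModuleAux l1_norm 1
    l1_norm_triangle l1_norm_scal_le l1_norm_compat1 l1_norm_compat2
    l1_norm_eq_zero.
Canonical l1_NormedModule :=
  NormedModule.Pack C_AbsRing l1
    (NormedModule.Class C_AbsRing l1
       (NormedModuleAux.class C_AbsRing l1_NormedModuleAux)
       l1_NormedModule_mixin) l1.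

Definition l1_nonneg (f : l1) : Prop :=
  forall n, 0 <= Re (f n) /\ Im (f n) = 0.

Definition l1_modulus_le (f g : l1) : Prop :=
  forall n, Cmod (f n) <= Cmod (g n).

Definition lattice_ideal (I : l1 -> Prop) : Prop :=
  I zero /\
  (forall f g, I f -> I g -> I (plus f g)) /\
  (forall (c : C) f, I f -> I (scal c f)) /\
  (forall f g, l1_modulus_le f g -> I g -> I f).

(** Coquelicot's [is_linear] includes boundedness. *)
Definition positive_operator (T : l1 -> l1) : Prop :=
  is_linear T /\ forall f, l1_nonneg f -> l1_nonneg (T f).

Definition stochastic (T : l1 -> l1) : Prop :=
  is_linear T /\
  forall f, l1_nonneg f -> l1_nonneg (T f) /\ norm (T f) = norm f.

Definition irreducible (T : l1 -> l1) : Prop :=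
  positive_operator T /\
  forall I : l1 -> Prop,
    closed I -> lattice_ideal I -> (forall f, I f -> I (T f)) ->
    (forall f, I f <-> f = zero) \/ (forall f, I f).

Definition spectrum {E : NormedModule C_AbsRing} (T : E -> E) (z : C) : Prop :=
  ~ exists S : E -> E,
      is_linear S /\
      (forall x, S (minus (scal z x) (T x)) = x) /\
      (forall x, minus (scal z (S x)) (T (S x)) = x).

Definition unit_circle (z : C) : Prop := Cmod z = 1.

(** Meaningful only for operators of spectral radius 1, such as stochastic
    ones. *)
Definition peripheral_spectrum {E : NormedModule C_AbsRing} (T : E -> E)
    (z : C) : Prop :=
  spectrum T z /\ unit_circle z.

Definition finite_circle_subgroup (G : C -> Prop) : Prop :=
  (forall z, G z -> unit_circle z) /\
  G 1%C /\
  (forall z w, G z -> G w -> G (z * w)%C) /\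
  (forall z, G z -> G (/ z)%C) /\
  (exists l : list C, forall z, G z -> List.In z l).

Definition finite_union_of_finite_circle_subgroups (U : C -> Prop) : Prop :=
  exists Gs : list (C -> Prop),
    List.Forall finite_circle_subgroup Gs /\
    forall z, U z <-> List.Exists (fun G => G z) Gs.

(* Main.v *)
Require Import Defs.
From Stdlib Require Import Reals Lra Lia List Permutation Classical.
From Coquelicot Require Import Coquelicot.

(** Every finite subgroup of the circle is a group of [d]-th roots of unity, so
    [U] is the set of all [z] with [z ^ d = 1] for some [d] in a list [ds]. Let
    [lossy] be a direct sum of infinitely many cyclic permutations, with every
    length in [ds] occurring infinitely often, the [q]-th block being damped by
    a factor [1 - eps_q] with [eps_q -> 0], and restore the lost mass by a rank
    one term: [T f = lossy f + loss f * half] with [half > 0] everywhere. All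
    matrix entries of [T] are positive, whence irreducibility. The eigenvectors
    of the undamped cycles are approximate eigenvectors of [T], so [U] lies in
    the spectrum. For [|z| = 1] outside [U] the inverse of [z - lossy] is given
    cycle by cycle by finite geometric sums, uniformly bounded; the rank one
    perturbation stays invertible unless [loss ((z - lossy)^-1 half) = 1],
    which would force [z = 1]. *)

(** * Finite subgroups of the circle *)

(** Polynomial functions of degree less than [n], in Horner form. *)
Fixpoint polyfun (n : nat) (p : C -> C) : Prop :=
  match n with
  | O => forall x, p x = 0
  | S n => exists c q, polyfun n q /\ forall x, p x = (c + x * q x)%C
  end.

(** Induction on the Horner form, by [x p'(x) - a p'(a) = x (p'(x) - p'(a)) + (x - a) p'(a)]. *)
Lemma polyfun_factor n : forall p a, polyfun (S n) p ->
  exists q, polyfun n q /\ forall x, (p x - p a)%C = ((x - a) * q x)%C.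
Proof.
induction n as [|n IH]; intros p a [c [p' [Hp' E]]].
- exists (fun _ => RtoC 0); split; [intros x; reflexivity |].
  intros x; rewrite !E; rewrite !Hp'; ring.
- destruct (IH p' a Hp') as [q' [Hq' E']].
  exists (fun x => (p' a + x * q' x)%C); split; [exists (p' a), q'; auto |].
  intros x; rewrite !E.
  replace (c + x * p' x - (c + a * p' a))%C
    with (x * (p' x - p' a) + (x - a) * p' a)%C by ring.
  rewrite E'; ring.
Qed.

(** Split off the root at the head of [l]: the quotient has one coefficient fewer and still vanishes
    at the remaining roots, which differ from it. *)
Lemma polyfun_roots n : forall p l, polyfun n p -> NoDup l ->
  (n <= length l)%nat -> (forall x, In x l -> p x = 0) -> forall x, p x = 0.
Proof.
induction n as [|n IH]; intros p l Hp Hl Hn H; [exact Hp |].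
destruct l as [|a l]; simpl in Hn; [lia |].
inversion_clear Hl as [|? ? Ha Hl'].
destruct (polyfun_factor n p a Hp) as [q [Hq E]].
assert (Hpa : p a = 0) by (apply H; left; reflexivity).
assert (Hq0 : forall x, q x = 0).
{ apply (IH q l); auto; [lia |]; intros x Hx.
  assert (Hxa : (x - a)%C <> 0).
  { intros H0; apply Ha; replace a with x; auto.
    replace x with (x - a + a)%C by ring; rewrite H0; ring. }
  specialize (E x); rewrite (H x), Hpa in E by (right; auto).
  replace (q x) with ((x - a) * q x / (x - a))%C by (field; auto).
  rewrite <- E; field; auto. }
intros x; specialize (E x); rewrite Hpa, Hq0 in E.
replace (p x) with (p x - 0)%C by ring; rewrite E; ring.
Qed.

Lemma polyfun_pow n : polyfun (S n) (fun x => (x ^ n)%C).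
Proof.
induction n as [|n IH].
- exists (RtoC 1), (fun _ => RtoC 0); split; [intros x; reflexivity |]; intros x; simpl; ring.
- exists (RtoC 0), (fun x => (x ^ n)%C); split; auto; intros x; simpl; ring.
Qed.

Definition Cprod (l : list C) : C := fold_right Cmult (RtoC 1) l.

Lemma Cprod_perm l l' : Permutation l l' -> Cprod l = Cprod l'.
Proof. induction 1; simpl in *; try congruence; ring. Qed.

Lemma Cprod_scal (z : C) (l : list C) : Cprod (map (Cmult z) l) = (z ^ length l * Cprod l)%C.
Proof. induction l as [|x l IH]; simpl; [| rewrite IH]; ring. Qed.

Lemma Cprod_neq_0 (l : list C) : (forall x : C, In x l -> x <> 0) -> Cprod l <> 0.
Proof.
induction l as [|x l IH]; simpl; intros H; [apply C1_nz |].
apply Cmult_neq_0; auto.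
Qed.

(** Turns the list bounding a finite subgroup, which may contain repetitions and strangers, into an
    exact enumeration. Membership is a mere proposition, hence the classical case split. *)
Lemma NoDup_filter_list (P : C -> Prop) (l : list C) :
  exists l', NoDup l' /\ forall z, In z l' <-> In z l /\ P z.
Proof.
induction l as [|x l [l' [H1 H2]]].
- exists nil; split; [constructor |]; simpl; tauto.
- destruct (classic (P x /\ ~ In x l')) as [[Hx Hx'] | Hx].
  + exists (x :: l'); split; [constructor; auto |].
    intros z; simpl; rewrite H2; intuition (subst; auto).
  + exists l'; split; auto; intros z; rewrite H2; simpl.
    split; [tauto |]; intros [[<- | Hz] Hp]; auto.
    apply H2, NNPP; intros Hn; apply Hx; auto.
Qed.

Lemma unit_circle_neq_0 (z : C) : unit_circle z -> z <> 0.
Proof. unfold unit_circle; intros H ->; rewrite Cmod_0 in H; lra. Qed.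

(** [n] is the order of [G]. Multiplication by [z] in [G] permutes [G], so the product [P] of all
    elements satisfies [P = z ^ n * P], whence [z ^ n = 1]. Conversely, [G] already exhausts the at
    most [n] roots of [x ^ n - 1]. *)
Lemma finite_circle_subgroup_roots G : finite_circle_subgroup G ->
  exists n, (0 < n)%nat /\ forall z, G z <-> (z ^ n)%C = 1.
Proof.
intros [Hc [H1 [Hm [_ [l0 Hl0]]]]].
destruct (NoDup_filter_list G l0) as [l [Hnd Hl']].
assert (Hl : forall z, In z l <-> G z).
{ intros z; rewrite Hl'; split; [tauto | auto]. }
assert (Hpow : forall z, G z -> (z ^ length l)%C = 1).
{ intros z Hz.
  assert (z0 := unit_circle_neq_0 z (Hc z Hz)).
  assert (P : Permutation l (map (Cmult z) l)).
  { symmetry; apply NoDup_Permutation_bis.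
    - apply FinFun.Injective_map_NoDup; auto.
      intros x y E; replace x with (z * x / z)%C by (field; auto).
      rewrite E; field; auto.
    - rewrite length_map; lia.
    - intros y Hy; apply in_map_iff in Hy; destruct Hy as [x [<- Hx]].
      apply Hl, Hm; auto; apply Hl; auto. }
  apply Cprod_perm in P; rewrite Cprod_scal in P.
  assert (Hp : Cprod l <> 0).
  { apply Cprod_neq_0; intros x Hx; apply unit_circle_neq_0, Hc, Hl, Hx. }
  replace (z ^ length l)%C with (z ^ length l * Cprod l / Cprod l)%C by (field; auto).
  rewrite <- P; field; auto. }
exists (length l).
assert (Hlen : (0 < length l)%nat).
{ destruct l; simpl; [exfalso; apply (Hl 1%C), H1 | lia]. }
split; auto; intros z; split; auto; intros Hz.
apply NNPP; intros HG.
destruct (length l) as [|n] eqn:En; [lia |].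
(* A root [z] outside [G] would be one root too many, so [x ^ S n - 1] would vanish identically,
   which is absurd at [x = 0]. *)
assert (Hroot : forall x : C, (x ^ S n - 1)%C = 0).
{ apply (polyfun_roots (S (S n)) _ (z :: l)).
  - exists (-1)%C, (fun x => (x ^ n)%C); split; [apply polyfun_pow |].
    intros x; simpl; ring.
  - constructor; auto; rewrite Hl; auto.
  - simpl; lia.
  - intros x [<- | Hx]; [rewrite Hz | rewrite Hpow by (apply Hl; auto)]; ring. }
specialize (Hroot (RtoC 0)); rewrite Cpow_S in Hroot.
apply C1_nz; replace (RtoC 1) with (- (0 * 0 ^ n - 1))%C by ring.
rewrite Hroot; ring.
Qed.

Lemma finite_union_roots U : (exists z : C, U z) ->
  finite_union_of_finite_circle_subgroups U ->
  exists ds : list nat, ds <> nil /\ List.Forall (lt 0) ds /\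
    forall z, U z <-> exists d, In d ds /\ (z ^ d)%C = 1.
Proof.
intros [z0 Hz0] [Gs [HG HU]].
assert (H : exists ds, List.Forall (lt 0) ds /\
  forall z : C, List.Exists (fun G : C -> Prop => G z) Gs <-> exists d, In d ds /\ (z ^ d)%C = 1).
{ clear -HG; induction HG as [|G Gs HG _ [ds [Hp IH]]].
  - exists nil; split; [constructor |]; intros z; rewrite Exists_nil.
    split; [tauto | intros [d [[] _]]].
  - destruct (finite_circle_subgroup_roots G HG) as [n [Hn E]].
    exists (n :: ds); split; [constructor; auto |].
    intros z; rewrite Exists_cons, IH, E; simpl; split.
    + intros [H | [d [H1 H2]]]; eauto.
    + intros [d [[<- | H1] H2]]; eauto. }
destruct H as [ds [Hp E]]; exists ds; split.
- intros ->; apply HU, E in Hz0; destruct Hz0 as [d [[] _]].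
- split; auto; intros z; rewrite HU; apply E.
Qed.

(** * Weighted composition operators on l1 *)

(** Sums over lists of indices rather than intervals, so that the image of an interval under an
    injection is again a legitimate index set. *)
Definition lsum (b : nat -> R) (l : list nat) : R :=
  fold_right (fun k s => b k + s) 0 l.

Lemma lsum_app b l l' : lsum b (l ++ l') = lsum b l + lsum b l'.
Proof. induction l as [|x l IH]; simpl; [| rewrite IH]; ring. Qed.

Lemma sum_n_lsum b n : sum_n b n = lsum b (seq 0 (S n)).
Proof.
induction n as [|n IH].
- rewrite sum_O; symmetry; apply Rplus_0_r.
- rewrite sum_Sn, seq_S, lsum_app, IH; simpl; rewrite Rplus_0_r; reflexivity.
Qed.

Lemma lsum_map b (rho : nat -> nat) l :
  lsum (fun k => b (rho k)) l = lsum b (map rho l).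
Proof. induction l as [|x l IH]; simpl; [| rewrite IH]; reflexivity. Qed.

Lemma lsum_ge_0 b l : (forall k, 0 <= b k) -> 0 <= lsum b l.
Proof.
intros Hb; induction l as [|x l IH]; simpl; [lra | specialize (Hb x); lra].
Qed.

Lemma lsum_incl b l : forall l', (forall k, 0 <= b k) -> NoDup l ->
  incl l l' -> lsum b l <= lsum b l'.
Proof.
induction l as [|x l IH]; intros l' Hb Hl Hi; simpl; [apply lsum_ge_0, Hb |].
destruct (in_split x l') as [l1 [l2 ->]]; [apply Hi; left; reflexivity |].
inversion_clear Hl as [|? ? Hx Hl'].
assert (H : lsum b l <= lsum b (l1 ++ l2)).
{ apply IH; auto; intros y Hy.
  assert (Hy' := Hi y (or_intror Hy)); apply in_app_iff in Hy'.
  apply in_app_iff; destruct Hy' as [H | [<- | H]]; auto; contradiction. }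
rewrite lsum_app in *; simpl; lra.
Qed.

Lemma sum_n_le_Series b n : (forall k, 0 <= b k) -> ex_series b ->
  sum_n b n <= Series b.
Proof.
intros Hb Hs.
apply (is_lim_seq_incr_compare (sum_n b)).
- apply Series_correct, Hs.
- intros k; rewrite sum_Sn; unfold plus; simpl; specialize (Hb (S k)); lra.
Qed.

Lemma lsum_le_Series b l : (forall k, 0 <= b k) -> ex_series b -> NoDup l ->
  lsum b l <= Series b.
Proof.
intros Hb Hs Hl.
apply Rle_trans with (sum_n b (list_max l)); [| apply sum_n_le_Series; auto].
rewrite sum_n_lsum; apply lsum_incl; auto; intros x Hx; apply in_seq.
assert (H : (list_max l <= list_max l)%nat) by lia.
apply list_max_le in H; rewrite List.Forall_forall in H.
specialize (H x Hx); lia.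
Qed.

(** Each partial sum on the left runs over finitely many distinct indices of [b], so the full sum of
    the nonnegative [b] bounds it. *)
Lemma Series_inj b (rho : nat -> nat) : (forall k, 0 <= b k) -> ex_series b ->
  (forall i j, rho i = rho j -> i = j) ->
  ex_series (fun k => b (rho k)) /\ Series (fun k => b (rho k)) <= Series b.
Proof.
intros Hb Hs Hr.
assert (Hn : forall n, sum_n (fun k => b (rho k)) n <= Series b).
{ intros n; rewrite sum_n_lsum, lsum_map; apply lsum_le_Series; auto.
  apply FinFun.Injective_map_NoDup; [exact Hr | apply seq_NoDup]. }
assert (He : ex_series (fun k => b (rho k))).
{ destruct (ex_finite_lim_seq_incr (sum_n (fun k => b (rho k))) (Series b))
    as [l Hl]; auto; [| exists l; exact Hl].
  intros n; rewrite sum_Sn; unfold plus; simpl; specialize (Hb (rho (S n))); lra. }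
split; auto.
apply (is_lim_seq_le (sum_n (fun k => b (rho k))) (fun _ => Series b)
         (Series (fun k => b (rho k))) (Series b)); auto.
- apply Series_correct, He.
- apply is_lim_seq_const.
Qed.

Lemma Series_bij b (rho rho' : nat -> nat) : (forall k, 0 <= b k) -> ex_series b ->
  (forall k, rho' (rho k) = k) -> (forall k, rho (rho' k) = k) ->
  Series (fun k => b (rho k)) = Series b.
Proof.
intros Hb Hs H1 H2.
destruct (Series_inj b rho) as [He Hle]; auto.
{ intros i j E; rewrite <- (H1 i), E; apply H1. }
apply Rle_antisym; auto.
destruct (Series_inj (fun k => b (rho k)) rho') as [He' Hle']; auto.
{ intros i j E; rewrite <- (H2 i), E; apply H2. }
erewrite Series_ext in Hle'; [exact Hle' |].
intros k; simpl; rewrite H2; reflexivity.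
Qed.

Definition bounded_seq (w : nat -> C) : Prop :=
  exists B, forall k, Cmod (w k) <= B.

Definition inj (rho : nat -> nat) : Prop := forall i j, rho i = rho j -> i = j.

Lemma ex_series_Rscal (B : R) (b : nat -> R) :
  ex_series b -> ex_series (fun k => B * b k).
Proof. intros H; apply (ex_series_scal_l (K := R_AbsRing) B b H). Qed.

Lemma wcomp_summable w rho (f : l1) : bounded_seq w -> inj rho ->
  ex_series (fun k => Cmod (w k * f (rho k))%C).
Proof.
intros [B HB] Hr.
apply summable_dominated with (fun k => B * Cmod (f (rho k))).
- intros k; rewrite Cmod_mult; apply Rmult_le_compat_r; [apply Cmod_ge_0 | auto].
- apply ex_series_Rscal, (Series_inj (fun k => Cmod (f k)) rho);
    [intros; apply Cmod_ge_0 | apply l1_summable | exact Hr].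
Qed.

Definition wcomp w rho (Hw : bounded_seq w) (Hr : inj rho) (f : l1) : l1 :=
  mk_l1 (wcomp_summable w rho f Hw Hr).

Lemma Series_nonneg b : (forall k, 0 <= b k) -> ex_series b -> 0 <= Series b.
Proof.
intros Hb Hs; apply Rle_trans with (2 := sum_n_le_Series b 0 Hb Hs).
rewrite sum_O; auto.
Qed.

Lemma l1_norm_ge_0 (f : l1) : 0 <= l1_norm f.
Proof. apply Series_nonneg; [intros; apply Cmod_ge_0 | apply l1_summable]. Qed.

Lemma wcomp_linear w rho (Hw : bounded_seq w) (Hr : inj rho) :
  is_linear (wcomp w rho Hw Hr).
Proof.
split.
- intros x y; apply l1_ext; intros k; simpl; ring.
- intros c x; apply l1_ext; intros k; simpl; ring.
(* The maximum with 1 is taken because [is_linear] asks for a strictly positive bound, while [B] may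
   be 0. *)
- pose proof Hw as [B HB]; exists (Rmax B 1).
  assert (HB1 := Rmax_l B 1); assert (HB2 := Rmax_r B 1).
  split; [lra |]; intros f.
  change (l1_norm (wcomp w rho Hw Hr f) <= Rmax B 1 * l1_norm f).
  destruct (Series_inj (fun k => Cmod (f k)) rho) as [He Hle];
    [intros; apply Cmod_ge_0 | apply l1_summable | exact Hr |].
  apply Rle_trans with (Rmax B 1 * Series (fun k => Cmod (f (rho k)))).
  + rewrite <- Series_scal_l; apply Series_le.
    * intros k; split; [apply Cmod_ge_0 |]; simpl; rewrite Cmod_mult.
      apply Rmult_le_compat_r; [apply Cmod_ge_0 |].
      specialize (HB k); lra.
    * apply ex_series_Rscal, He.
  + apply Rmult_le_compat_l; [lra | exact Hle].
Qed.

Lemma is_linear_add {E F : NormedModule C_AbsRing} (A B : E -> F) :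
  is_linear A -> is_linear B -> is_linear (fun x => plus (A x) (B x)).
Proof.
intros HA HB.
exact (is_linear_comp _ _ (is_linear_prod A B HA HB) is_linear_plus).
Qed.

(** * The summation functional on l1 *)

Definition csum (f : l1) : C :=
  (Series (fun k => Re (f k)), Series (fun k => Im (f k))).

Lemma Rabs_Im_le_Cmod z : Rabs (Im z) <= Cmod z.
Proof.
apply Rle_trans with (2 := Rmax_Cmod z); apply Rmax_r.
Qed.

Lemma ex_series_Re (f : l1) : ex_series (fun k => Re (f k)).
Proof.
apply (@ex_series_le R_AbsRing R_CompleteNormedModule _ (fun k => Cmod (f k)));
  [| apply l1_summable].
intros k; apply re_le_Cmod.
Qed.

Lemma ex_series_Im (f : l1) : ex_series (fun k => Im (f k)).
Proof.
apply (@ex_series_le R_AbsRing R_CompleteNormedModule _ (fun k => Cmod (f k)));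
  [| apply l1_summable].
intros k; apply Rabs_Im_le_Cmod.
Qed.

Lemma Rabs_Series_le (a b : nat -> R) : (forall k, Rabs (a k) <= b k) ->
  ex_series b -> Rabs (Series a) <= Series b.
Proof.
intros H Hb.
assert (Ha : ex_series (fun k => Rabs (a k))).
{ apply (@ex_series_le R_AbsRing R_CompleteNormedModule _ b); auto.
  intros k; change (Rabs (Rabs (a k)) <= b k); rewrite Rabs_Rabsolu; auto. }
apply Rle_trans with (1 := Series_Rabs a Ha), Series_le; auto.
intros k; split; [apply Rabs_pos | auto].
Qed.

Lemma Cmod_le_Re_Im z : Cmod z <= Rabs (Re z) + Rabs (Im z).
Proof.
destruct z as [x y]; unfold Cmod; simpl.
assert (Hx := Rabs_pos x); assert (Hy := Rabs_pos y).
rewrite <- (sqrt_Rsqr (Rabs x + Rabs y)) by lra.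
apply sqrt_le_1_alt.
assert (Hx2 := Rsqr_abs x); assert (Hy2 := Rsqr_abs y); unfold Rsqr in *; nra.
Qed.

(** The factor 2 comes from bounding the real and imaginary sums separately. *)
Lemma csum_bound f : Cmod (csum f) <= 2 * l1_norm f.
Proof.
apply Rle_trans with (1 := Cmod_le_Re_Im _); simpl.
assert (Rabs (Series (fun k => Re (f k))) <= l1_norm f)
  by (apply Rabs_Series_le; [intros k; apply re_le_Cmod | apply l1_summable]).
assert (Rabs (Series (fun k => Im (f k))) <= l1_norm f)
  by (apply Rabs_Series_le; [intros k; apply Rabs_Im_le_Cmod | apply l1_summable]).
lra.
Qed.

Lemma csum_linear : is_linear (U := l1_NormedModule)
  (V := AbsRing_NormedModule C_AbsRing) csum.
Proof.
split.
- intros x y; unfold csum; apply injective_projections; simpl.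
  + apply (Series_plus (fun k => Re (x k))); apply ex_series_Re.
  + apply (Series_plus (fun k => Im (x k))); apply ex_series_Im.
- intros c x; unfold csum; apply injective_projections; simpl.
  + rewrite <- !Series_scal_l, <- Series_minus;
      [reflexivity | |]; apply ex_series_Rscal; [apply ex_series_Re | apply ex_series_Im].
  + rewrite <- !Series_scal_l, <- Series_plus;
      [reflexivity | |]; apply ex_series_Rscal; [apply ex_series_Im | apply ex_series_Re].
- exists 2; split; [lra | exact csum_bound].
Qed.

(** * The chain *)

(** The states are cut into consecutive blocks of [width] states, and block [q] into cycles of
    length [cyc q]. One width divisible by all cycle lengths aligns every cycle with multiples of
    its own length. *)
Record blocks := {
  width : nat;
  cyc : nat -> nat;
  width_pos : (0 < width)%nat;
  cyc_div : forall q, Nat.divide (cyc q) width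
}.

Definition per (B : blocks) (k : nat) : nat := cyc B (k / width B).

(** The first summand is the first state of the cycle of [k], the second the position on that cycle
    after [c] further steps. *)
Definition rot (B : blocks) (c k : nat) : nat :=
  (per B k * (k / per B k) + (k + c) mod per B k)%nat.

Lemma per_pos B k : (0 < per B k)%nat.
Proof.
destruct (cyc_div B (k / width B)) as [c Hc]; fold (per B k) in Hc.
assert (H := width_pos B); destruct (per B k); lia.
Qed.

Lemma rot_div_per B c k : (rot B c k / per B k = k / per B k)%nat.
Proof.
assert (H := per_pos B k).
unfold rot; rewrite Nat.mul_comm, Nat.div_add_l by lia.
rewrite Nat.div_small with (a := ((k + c) mod per B k)%nat)
  by (apply Nat.mod_upper_bound; lia).
lia.
Qed.

Lemma rot_div_width B c k : (rot B c k / width B = k / width B)%nat.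
Proof.
destruct (cyc_div B (k / width B)) as [m Hm]; fold (per B k) in Hm.
rewrite Hm, Nat.mul_comm, <- !Nat.Div0.div_div, rot_div_per; reflexivity.
Qed.

Lemma rot_per B c k : per B (rot B c k) = per B k.
Proof. unfold per at 1; rewrite rot_div_width; reflexivity. Qed.

Lemma rot_rot B c c' k : rot B c' (rot B c k) = rot B (c + c') k.
Proof.
unfold rot at 1; rewrite rot_per, rot_div_per; unfold rot; f_equal.
rewrite <- Nat.add_assoc, Nat.mul_comm, Nat.add_comm, Nat.Div0.mod_add.
rewrite Nat.Div0.add_mod_idemp_l; f_equal; lia.
Qed.

Lemma rot_mul_per B m k : rot B (m * per B k) k = k.
Proof.
unfold rot; rewrite Nat.Div0.mod_add; symmetry; apply Nat.div_mod.
assert (H := per_pos B k); lia.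
Qed.

Lemma rot_mul_width B m k : rot B (m * width B) k = k.
Proof.
destruct (cyc_div B (k / width B)) as [c Hc]; fold (per B k) in Hc.
rewrite Hc, Nat.mul_assoc; apply rot_mul_per.
Qed.

(** [width B] steps are a whole number of turns on every cycle, so the same number of further steps
    undoes [c] steps everywhere. *)
Lemma rot_inv_l B c k : rot B (c * (width B - 1)) (rot B c k) = k.
Proof.
rewrite rot_rot; replace (c + c * (width B - 1))%nat with (c * width B)%nat.
- apply rot_mul_width.
- assert (H := width_pos B); nia.
Qed.

Lemma rot_inv_r B c k : rot B c (rot B (c * (width B - 1)) k) = k.
Proof. rewrite rot_rot, Nat.add_comm, <- rot_rot; apply rot_inv_l. Qed.

Lemma rot_inj B c : inj (rot B c).
Proof.
intros i j E; rewrite <- (rot_inv_l B c i), E; apply rot_inv_l.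
Qed.

Lemma id_inj : inj (fun k => k).
Proof. intros i j; auto. Qed.

(** The leak is constant on blocks and tends to 0 along them; the summand 2 keeps it strictly below
    1 already in block 0. *)
Definition leak (B : blocks) (k : nat) : R := / (INR (k / width B) + 2).

Lemma leak_rot B c k : leak B (rot B c k) = leak B k.
Proof. unfold leak; rewrite rot_div_width; reflexivity. Qed.

Lemma leak_bounds B k : 0 < leak B k < 1.
Proof.
unfold leak; assert (H := pos_INR (k / width B)); split.
- apply Rinv_0_lt_compat; lra.
- rewrite <- Rinv_1; apply Rinv_lt_contravar; lra.
Qed.

Lemma leak_bounded B : bounded_seq (fun k => RtoC (leak B k)).
Proof.
exists 1; intros k; rewrite Cmod_R; assert (H := leak_bounds B k).
rewrite Rabs_pos_eq; lra.
Qed.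

Lemma stay_bounded B : bounded_seq (fun k => RtoC (1 - leak B k)).
Proof.
exists 1; intros k; rewrite Cmod_R; assert (H := leak_bounds B k).
rewrite Rabs_pos_eq; lra.
Qed.

Lemma is_series_half : is_series (fun k => (1 / 2) ^ S k) 1.
Proof.
assert (H := is_series_geom (1 / 2)); rewrite Rabs_pos_eq in H by lra.
specialize (H ltac:(lra)).
assert (E : scal (1 / 2) (/ (1 - 1 / 2)) = 1)
  by (change (1 / 2 * / (1 - 1 / 2) = 1); field).
exact (eq_ind _ (is_series (fun k => (1 / 2) ^ S k))
  (is_series_scal_l (K := R_AbsRing) (1 / 2) _ _ H) _ E).
Qed.

Lemma half_pos k : 0 < (1 / 2) ^ S k.
Proof. apply pow_lt; lra. Qed.

Lemma half_summable : ex_series (fun k => Cmod (RtoC ((1 / 2) ^ S k))).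
Proof.
exists 1; eapply is_series_ext; [| apply is_series_half].
intros k; rewrite Cmod_R, Rabs_pos_eq; [reflexivity | apply Rlt_le, half_pos].
Qed.

Definition half : l1 := mk_l1 half_summable.

Lemma half_norm : l1_norm half = 1.
Proof.
apply is_series_unique; eapply is_series_ext; [| apply is_series_half].
intros k; simpl l1_seq; rewrite Cmod_R, Rabs_pos_eq;
  [reflexivity | apply Rlt_le, half_pos].
Qed.

(** As a pullback along [rot B 1], this sends mass from [rot B 1 k] to [k]. The leak agrees at both
    states, so it does not matter at which end the damping is read off. *)
Definition lossy (B : blocks) : l1 -> l1 :=
  wcomp _ _ (stay_bounded B) (rot_inj B 1).

Definition loss (B : blocks) (f : l1) : C :=
  csum (wcomp _ _ (leak_bounded B) id_inj f).

(** Every state of the [q]-th block of [width B] states moves along its cycle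
    of length [cyc B q] with probability [1 - 1 / (q + 2)] and otherwise
    restarts from the fully supported distribution [half]. *)
Definition chain (B : blocks) (f : l1) : l1 :=
  l1_plus (lossy B f) (l1_scal (loss B f) half).

Lemma loss_linear B : is_linear (U := l1_NormedModule)
  (V := AbsRing_NormedModule C_AbsRing) (loss B).
Proof. exact (is_linear_comp _ _ (wcomp_linear _ _ _ _) csum_linear). Qed.

Lemma rank_one_linear B (v : l1) :
  is_linear (fun f : l1 => l1_scal (loss B f) v).
Proof.
exact (is_linear_comp _ _ (loss_linear B) (is_linear_scal_l (v : l1_NormedModule))).
Qed.

Lemma chain_linear B : is_linear (chain B).
Proof.
exact (is_linear_add _ _ (wcomp_linear _ _ _ _) (rank_one_linear B half)).
Qed.

(** * Positivity and conservation of mass *)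

Lemma Re_loss B f : Re (loss B f) = Series (fun k => leak B k * Re (f k)).
Proof. simpl; apply Series_ext; intros k; unfold Re, Im; simpl; ring. Qed.

Lemma Im_loss B f : Im (loss B f) = Series (fun k => leak B k * Im (f k)).
Proof. simpl; apply Series_ext; intros k; unfold Re, Im; simpl; ring. Qed.

Lemma ex_series_bounded_mul (b u : nat -> R) : ex_series b ->
  (forall k, 0 <= b k) -> (forall k, 0 <= u k <= 1) ->
  ex_series (fun k => u k * b k).
Proof.
intros Hs Hb Hu; apply (@ex_series_le R_AbsRing R_CompleteNormedModule _ b); auto.
intros k; change (Rabs (u k * b k) <= b k).
specialize (Hb k); specialize (Hu k); rewrite Rabs_pos_eq; nra.
Qed.

Lemma ex_series_stay_Cmod B (f : l1) :
  ex_series (fun k => (1 - leak B k) * Cmod (f k)).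
Proof.
apply ex_series_bounded_mul; [apply l1_summable | intros; apply Cmod_ge_0 |].
intros k; assert (H := leak_bounds B k); lra.
Qed.

Lemma ex_series_leak_Cmod B (f : l1) :
  ex_series (fun k => leak B k * Cmod (f k)).
Proof.
apply ex_series_bounded_mul; [apply l1_summable | intros; apply Cmod_ge_0 |].
intros k; assert (H := leak_bounds B k); lra.
Qed.

Lemma ex_series_lossy B (f : l1) :
  ex_series (fun k => (1 - leak B k) * Cmod (f (rot B 1 k))).
Proof.
apply (ex_series_ext (fun k => Cmod (lossy B f k))); [| apply l1_summable].
intros k; simpl; rewrite Cmod_mult, Cmod_R, Rabs_pos_eq; auto.
assert (H := leak_bounds B k); lra.
Qed.

(** The leak is constant on cycles, so reindexing by the bijection [rot B 1] removes the
    rotation. *)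
Lemma lossy_mass B (f : l1) :
  Series (fun k => (1 - leak B k) * Cmod (f (rot B 1 k))) =
  l1_norm f - Series (fun k => leak B k * Cmod (f k)).
Proof.
transitivity (Series (fun k => (1 - leak B k) * Cmod (f k))).
- rewrite <- (Series_bij (fun k => (1 - leak B k) * Cmod (f k))
                (rot B 1) (rot B (1 * (width B - 1)))).
  + apply Series_ext; intros k; rewrite leak_rot; reflexivity.
  + intros k; apply Rmult_le_pos; [| apply Cmod_ge_0].
    assert (H := leak_bounds B k); lra.
  + apply ex_series_stay_Cmod.
  + apply rot_inv_l.
  + apply rot_inv_r.
- unfold l1_norm; rewrite <- Series_minus;
    [| apply l1_summable | apply ex_series_leak_Cmod].
  apply Series_ext; intros k; ring.
Qed.

Lemma l1_nonneg_Cmod f k : l1_nonneg f -> f k = RtoC (Cmod (f k)).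
Proof.
intros H; destruct (H k) as [H1 H2]; destruct (f k) as [x y]; simpl in *.
subst y; change (x, 0) with (RtoC x); rewrite Cmod_R, Rabs_pos_eq; auto.
Qed.

Lemma loss_nonneg B f : l1_nonneg f ->
  loss B f = RtoC (Series (fun k => leak B k * Cmod (f k))).
Proof.
intros H; apply injective_projections.
- change (Re (loss B f) = Series (fun k => leak B k * Cmod (f k))).
  rewrite Re_loss; apply Series_ext; intros k.
  rewrite (l1_nonneg_Cmod f k H) at 1; reflexivity.
- change (Im (loss B f) = 0); rewrite Im_loss.
  (* The zero series is written as [0 * 0] so that pulling out the factor gives its value at
     once. *)
  rewrite (Series_ext _ (fun k => 0 * 0)), Series_scal_l; [ring |].
  intros k; rewrite (proj2 (H k)); ring.
Qed.

Lemma loss_mass_ge_0 B (f : l1) : 0 <= Series (fun k => leak B k * Cmod (f k)).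
Proof.
apply Series_nonneg; [| apply ex_series_leak_Cmod].
intros k; apply Rmult_le_pos; [| apply Cmod_ge_0].
assert (H := leak_bounds B k); lra.
Qed.

Lemma chain_nonneg_coord B f k : l1_nonneg f ->
  chain B f k = RtoC ((1 - leak B k) * Cmod (f (rot B 1 k)) +
    Series (fun i => leak B i * Cmod (f i)) * (1 / 2) ^ S k).
Proof.
intros H; unfold chain; rewrite (loss_nonneg B f H).
simpl; rewrite (l1_nonneg_Cmod f (rot B 1 k) H) at 1.
rewrite RtoC_plus, !RtoC_mult; reflexivity.
Qed.

Lemma chain_nonneg_coord_pos B (f : l1) k : l1_nonneg f ->
  0 <= (1 - leak B k) * Cmod (f (rot B 1 k)) +
    Series (fun i => leak B i * Cmod (f i)) * (1 / 2) ^ S k.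
Proof.
intros H; assert (H1 := leak_bounds B k).
apply Rplus_le_le_0_compat; apply Rmult_le_pos; try lra.
- apply Cmod_ge_0.
- apply loss_mass_ge_0.
- apply Rlt_le, half_pos.
Qed.

Lemma chain_positive B f : l1_nonneg f -> l1_nonneg (chain B f).
Proof.
intros H k; rewrite (chain_nonneg_coord B f k H); split; [| reflexivity].
apply (chain_nonneg_coord_pos B f k H).
Qed.

(** The mass missing from [lossy] is exactly the coefficient of [half], and [half] has total mass
    1. *)
Lemma chain_stochastic B : stochastic (chain B).
Proof.
split; [apply chain_linear |]; intros f Hf; split; [apply chain_positive, Hf |].
change (l1_norm (chain B f) = l1_norm f).
assert (Hhalf := is_series_half).
transitivity (Series (fun k => (1 - leak B k) * Cmod (f (rot B 1 k)) +
    Series (fun i => leak B i * Cmod (f i)) * (1 / 2) ^ S k)).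
- apply Series_ext; intros k; rewrite (chain_nonneg_coord B f k Hf).
  rewrite Cmod_R; apply Rabs_pos_eq, chain_nonneg_coord_pos, Hf.
- rewrite Series_plus.
  + rewrite lossy_mass, Series_scal_l, (is_series_unique _ _ Hhalf); ring.
  + apply ex_series_lossy.
  + apply ex_series_Rscal; exists 1; exact Hhalf.
Qed.

(** * Irreducibility *)

Lemma l1_abs_summable (f : l1) : ex_series (fun k => Cmod (RtoC (Cmod (f k)))).
Proof.
apply (ex_series_ext (fun k => Cmod (f k))); [| apply l1_summable].
intros k; rewrite Cmod_R, Rabs_pos_eq; [reflexivity | apply Cmod_ge_0].
Qed.

Definition l1_abs (f : l1) : l1 := mk_l1 (l1_abs_summable f).

Lemma l1_abs_nonneg f : l1_nonneg (l1_abs f).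
Proof. intros k; split; [apply Cmod_ge_0 | reflexivity]. Qed.

Lemma Cmod_l1_abs f k : Cmod (l1_abs f k) = Cmod (f k).
Proof. simpl; rewrite Cmod_R; apply Rabs_pos_eq, Cmod_ge_0. Qed.

(** With [f] the ideal contains its modulus, which leaks a positive mass [c] since every leak is
    positive. The image of the modulus under the chain then dominates [c] times [half]. *)
Lemma ideal_half B I f : lattice_ideal I -> (forall g, I g -> I (chain B g)) ->
  I f -> f <> l1_zero -> I half.
Proof.
intros [_ [_ [Hs Hm]]] HT Hf Hf0.
assert (Ha : I (l1_abs f)).
{ apply Hm with f; auto; intros k; rewrite Cmod_l1_abs; lra. }
set (c := Series (fun i => leak B i * Cmod (l1_abs f i))).
assert (Hc : 0 < c).
{ destruct (classic (exists k, f k <> 0)) as [[k Hk] | Hn].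
  - assert (H1 : 0 < leak B k * Cmod (f k)).
    { apply Rmult_lt_0_compat; [apply leak_bounds | apply Cmod_gt_0, Hk]. }
    apply Rlt_le_trans with (1 := H1).
    replace (leak B k * Cmod (f k))
      with (lsum (fun i => leak B i * Cmod (l1_abs f i)) (k :: nil))
      by (unfold lsum, fold_right; rewrite Cmod_l1_abs; ring).
    apply lsum_le_Series.
    + intros i; apply Rmult_le_pos; [apply Rlt_le, leak_bounds | apply Cmod_ge_0].
    + apply ex_series_leak_Cmod.
    + constructor; [intros [] | constructor].
  - exfalso; apply Hf0, l1_ext; intros k; apply NNPP; intros Hk; apply Hn.
    exists k; exact Hk. }
apply Hm with (scal (RtoC (/ c)) (chain B (l1_abs f))).
- intros k; change (Cmod (RtoC ((1 / 2) ^ S k)) <=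
    Cmod (RtoC (/ c) * chain B (l1_abs f) k)%C).
  rewrite chain_nonneg_coord by apply l1_abs_nonneg; fold c.
  rewrite <- RtoC_mult, !Cmod_R.
  assert (Hk := half_pos k); assert (Hl := leak_bounds B k).
  rewrite Rabs_pos_eq by lra.
  apply Rle_trans with (2 := Rle_abs _).
  apply Rmult_le_reg_l with c; auto.
  rewrite <- Rmult_assoc, Rinv_r, Rmult_1_l by lra.
  assert (0 <= (1 - leak B k) * Cmod (l1_abs f (rot B 1 k)))
    by (apply Rmult_le_pos; [lra | apply Cmod_ge_0]).
  lra.
- apply Hs, HT, Ha.
Qed.

Lemma truncate_summable (h : l1) n :
  ex_series (fun k => Cmod (if (k <=? n)%nat then h k else 0)).
Proof.
apply summable_dominated with (fun k => Cmod (h k)); [| apply l1_summable].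
intros k; destruct (k <=? n)%nat; [lra | rewrite Cmod_0; apply Cmod_ge_0].
Qed.

Definition truncate (h : l1) (n : nat) : l1 := mk_l1 (truncate_summable h n).

Lemma truncate_approx (h : l1) (eps : posreal) :
  exists n, ball (h : l1_UniformSpace) eps (truncate h n).
Proof.
assert (H := Series_correct _ (l1_summable h)).
apply is_series_Reals in H; destruct (H eps (cond_pos eps)) as [n Hn].
exists n; specialize (Hn n (le_n n)).
change (l1_norm (l1_plus (truncate h n) (l1_opp h)) < eps).
rewrite <- l1_norm_opp; unfold l1_norm.
rewrite (Series_incr_n (fun k => Cmod (h k)) (S n)) in Hn
  by (try apply Nat.lt_0_succ; apply l1_summable).
rewrite (Series_incr_n _ (S n)) by (try apply Nat.lt_0_succ; apply l1_summable).
unfold R_dist in Hn; simpl pred in *.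
match goal with |- ?a + ?b < _ =>
  replace a with 0; [replace b with (Series (fun k => Cmod (h (S n + k)%nat))) |] end.
- apply Rabs_def2 in Hn; lra.
- apply Series_ext; intros k; f_equal.
  unfold l1_opp, l1_plus, truncate; cbn [l1_seq].
  replace (S n + k <=? n)%nat with false by (symmetry; apply Nat.leb_gt; lia).
  ring.
- symmetry; apply sum_eq_R0; intros k Hk.
  unfold l1_opp, l1_plus, truncate; cbn [l1_seq].
  replace (k <=? n)%nat with true by (symmetry; apply Nat.leb_le; lia).
  replace (- (h k + - h k))%C with (RtoC 0) by ring; apply Cmod_0.
Qed.

(** As [half] is strictly positive, its multiples dominate every truncation of [h]; the truncations
    converge to [h] and [I] is closed. *)
Lemma ideal_half_full I : closed (I : l1_UniformSpace -> Prop) ->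
  lattice_ideal I -> I half -> forall h, I h.
Proof.
intros Hcl [_ [_ [Hs Hm]]] Hh h.
(* [closed] is stated contrapositively: it suffices that no ball around [h] avoids [I]. *)
apply Hcl; intros [eps Heps].
destruct (truncate_approx h eps) as [n Hn].
apply (Heps _ Hn); clear Heps Hn.
(* For [k <= n] the factor [2 ^ S n] outweighs [(1 / 2) ^ S k], and [l1_norm h] bounds every
   coordinate of [h]. *)
apply Hm with (scal (RtoC (l1_norm h * 2 ^ S n)) half); [| apply Hs, Hh].
intros k; change (Cmod (if (k <=? n)%nat then h k else 0) <=
  Cmod (RtoC (l1_norm h * 2 ^ S n) * RtoC ((1 / 2) ^ S k))%C).
destruct (Nat.leb_spec k n) as [Hk | Hk]; [| rewrite Cmod_0; apply Cmod_ge_0].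
rewrite <- RtoC_mult, Cmod_R.
apply Rle_trans with (2 := Rle_abs _), Rle_trans with (1 := Cmod_le_l1_norm h k).
assert (H0 := l1_norm_ge_0 h).
assert (H1 : 1 <= 2 ^ S n * (1 / 2) ^ S k).
{ apply Rle_trans with (2 ^ S k * (1 / 2) ^ S k).
  - rewrite <- Rpow_mult_distr; replace (2 * (1 / 2)) with 1 by field.
    rewrite pow1; lra.
  - apply Rmult_le_compat_r; [apply Rlt_le, half_pos |].
    apply Rle_pow; [lra | lia]. }
nra.
Qed.

Lemma chain_irreducible B : irreducible (chain B).
Proof.
split; [split; [apply chain_linear | apply chain_positive] |].
intros I Hcl Hid HT.
destruct (classic (exists f, I f /\ f <> l1_zero)) as [[f [Hf Hf0]] | Hn].
- right; apply ideal_half_full; auto; apply (ideal_half B I f); auto.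
- left; intros f; split; [| intros ->; apply Hid].
  intros Hf; apply NNPP; intros Hf0; apply Hn; exists f; auto.
Qed.

(** * Spectrum *)

(** The Sherman-Morrison formula: with [R0] the inverse of [z - D], the inverse of [z - T] is
    [h |-> R0 h + phi (R0 h) v], where [v = R0 e / (1 - phi (R0 e))]. *)
Lemma resolvent_rank_one (D T R0 : l1 -> l1) (phi : l1 -> C) (e : l1) (z : C) :
  is_linear R0 ->
  is_linear (U := l1_NormedModule) (V := AbsRing_NormedModule C_AbsRing) phi ->
  (forall x, T x = l1_plus (D x) (l1_scal (phi x) e)) ->
  (forall x k, R0 (l1_plus (l1_scal z x) (l1_opp (D x))) k = x k) ->
  (forall x k, (z * R0 x k - D (R0 x) k)%C = x k) ->
  is_linear D ->
  (1 - phi (R0 e))%C <> 0 -> ~ spectrum T z.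
Proof.
intros HR Hphi HT H1 H2 HD Hd Hsp; apply Hsp; clear Hsp.
set (v := l1_scal (/ (1 - phi (R0 e))) (R0 e)).
assert (Rp : forall x y, R0 (l1_plus x y) = l1_plus (R0 x) (R0 y))
  by exact (linear_plus R0 HR).
assert (Rs : forall a x, R0 (l1_scal a x) = l1_scal a (R0 x))
  by exact (linear_scal R0 HR).
assert (Dp : forall x y, D (l1_plus x y) = l1_plus (D x) (D y))
  by exact (linear_plus D HD).
assert (Ds : forall a x, D (l1_scal a x) = l1_scal a (D x))
  by exact (linear_scal D HD).
assert (Pp : forall x y, phi (l1_plus x y) = (phi x + phi y)%C)
  by exact (linear_plus _ Hphi).
assert (Ps : forall a x, phi (l1_scal a x) = (a * phi x)%C)
  by exact (linear_scal _ Hphi).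
exists (fun h => l1_plus (R0 h) (l1_scal (phi (R0 h)) v)).
split; [| split].
- refine (is_linear_comp R0 (fun h => l1_plus h (l1_scal (phi h) v)) HR _).
  refine (is_linear_add _ _ is_linear_id _).
  exact (is_linear_comp _ _ Hphi (is_linear_scal_l (v : l1_NormedModule))).
- intros x; change (minus (scal z x) (T x))
    with (l1_plus (l1_scal z x) (l1_opp (T x))).
  assert (E : R0 (l1_plus (l1_scal z x) (l1_opp (T x))) =
    l1_plus x (l1_scal (- phi x)%C (R0 e))).
  { replace (l1_plus (l1_scal z x) (l1_opp (T x))) with
      (l1_plus (l1_plus (l1_scal z x) (l1_opp (D x))) (l1_scal (- phi x)%C e))
      by (rewrite HT; apply l1_ext; intros k; simpl; ring).
    rewrite Rp, Rs; apply l1_ext; intros k; simpl; rewrite H1; reflexivity. }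
  rewrite E, Pp, Ps; apply l1_ext; intros k; simpl; field; auto.
- intros x; set (h := l1_plus (R0 x) (l1_scal (phi (R0 x)) v)).
  change (minus (scal z h) (T h)) with (l1_plus (l1_scal z h) (l1_opp (T h))).
  unfold h, v; rewrite HT, Pp, Dp, !Ps, !Ds.
  apply l1_ext; intros k; simpl.
  rewrite <- (H2 x k); transitivity (z * R0 x k - D (R0 x) k +
    phi (R0 x) * / (1 - phi (R0 e)) *
      ((z * R0 e k - D (R0 e) k) - e k))%C; [field; auto | rewrite !H2; ring].
Qed.

(** * The resolvent on the circle outside [U] *)

Section Resolvent.

Variables (B : blocks) (z : C) (c : R).
Hypothesis z_unit : Cmod z = 1.
Hypothesis c_pos : 0 < c.
Hypothesis gap : forall k, c <= Cmod (z ^ per B k - 1)%C.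

(** The equation [z g - lossy g = f] reads [g k = f k / z + ratio k * g (rot B 1 k)]; following it
    once around the cycle of [k] gives a finite geometric sum. *)
Definition ratio (k : nat) : C := (RtoC (1 - leak B k) / z)%C.

Lemma z_neq_0 : z <> 0.
Proof. apply unit_circle_neq_0, z_unit. Qed.

(** For [|w| = 1] and [0 <= t <= 1], [|w - 1| <= |w - t| + (1 - t)
    <= 2 |w - t|]; this makes the gap uniform in the leak. *)
Lemma ratio_gap k : c / 2 <= Cmod (z * (1 - ratio k ^ per B k))%C.
Proof.
assert (Hz := z_neq_0).
set (t := (1 - leak B k) ^ per B k).
assert (Hl := leak_bounds B k).
assert (Ht : 0 <= t <= 1).
{ split; [apply pow_le; lra |].
  apply Rle_trans with (1 ^ per B k); [apply pow_incr; lra | rewrite pow1; lra]. }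
assert (Hw : Cmod (z ^ per B k) = 1) by (rewrite Cmod_pow, z_unit; apply pow1).
assert (E : Cmod (z * (1 - ratio k ^ per B k)) = Cmod (z ^ per B k - t)).
{ transitivity (Cmod (z ^ per B k * (1 - ratio k ^ per B k))).
  { rewrite !Cmod_mult, z_unit, Hw; reflexivity. }
  f_equal; unfold ratio, t, Cdiv; rewrite Cpow_mult_l, Cpow_inv, <- RtoC_pow by auto.
  field; apply Cpow_nz; auto. }
rewrite E; specialize (gap k).
assert (H1 : Cmod (z ^ per B k - 1) <= Cmod (z ^ per B k - t) + Cmod (RtoC (t - 1))).
{ replace (z ^ per B k - 1)%C with (z ^ per B k - t + RtoC (t - 1))%C
    by (rewrite RtoC_minus; ring).
  apply Cmod_triangle. }
assert (H2 : Cmod (z ^ per B k) <= Cmod (z ^ per B k - t) + Cmod (RtoC t)).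
{ replace (z ^ per B k)%C with (z ^ per B k - t + RtoC t)%C at 1 by ring.
  apply Cmod_triangle. }
rewrite Cmod_R, Rabs_left1 in H1 by lra.
rewrite Cmod_R, Rabs_pos_eq in H2 by lra.
lra.
Qed.

(** The coefficient of [f (rot B j k)] in that solution. It is cut off after one turn, so that
    summing over [j < width B] serves cycles of all lengths. *)
Definition weight (j k : nat) : C :=
  if (j <? per B k)%nat then (ratio k ^ j / (z * (1 - ratio k ^ per B k)))%C
  else 0.

Lemma weight_bounded j : bounded_seq (weight j).
Proof.
exists (2 / c); intros k; unfold weight.
assert (H2 : 0 < 2 / c) by (apply Rdiv_lt_0_compat; lra).
destruct (j <? per B k)%nat; [| rewrite Cmod_0; lra].
assert (G := ratio_gap k).
rewrite Cmod_div by (apply Cmod_gt_0; lra).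
assert (H1 : Cmod (ratio k ^ j) <= 1).
{ rewrite Cmod_pow; unfold ratio; rewrite Cmod_div, z_unit, Cmod_R by apply z_neq_0.
  assert (Hl := leak_bounds B k); rewrite Rabs_pos_eq, Rdiv_1_r by lra.
  apply Rle_trans with (1 ^ j); [apply pow_incr; lra | rewrite pow1; lra]. }
apply Rle_trans with (1 / (c / 2)); [| right; field; lra].
assert (H0 := Cmod_ge_0 (ratio k ^ j)).
unfold Rdiv at 1 2; apply Rmult_le_compat; auto.
- apply Rlt_le, Rinv_0_lt_compat; lra.
- apply Rinv_le_contravar; lra.
Qed.

Lemma weight_rot j i k : weight j (rot B i k) = weight j k.
Proof. unfold weight, ratio; rewrite rot_per, leak_rot; reflexivity. Qed.

Fixpoint geom (n : nat) (f : l1) : l1 :=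
  match n with
  | O => l1_zero
  | S n => l1_plus (geom n f) (wcomp _ _ (weight_bounded n) (rot_inj B n) f)
  end.

Lemma geom_linear n : is_linear (geom n).
Proof.
induction n as [|n IH]; [exact is_linear_zero |].
exact (is_linear_add _ _ IH (wcomp_linear _ _ _ _)).
Qed.

Lemma geom_S n f k :
  geom (S n) f k = (geom n f k + weight n k * f (rot B n k))%C.
Proof. reflexivity. Qed.

Lemma lossy_coord f k :
  lossy B f k = (RtoC (1 - leak B k) * f (rot B 1 k))%C.
Proof. reflexivity. Qed.

(** Rotations commute, and weights and leaks are constant on cycles. This makes the right inverse
    [geom (width B)] of [z - lossy] a left inverse too. *)
Lemma geom_lossy n f k : geom n (lossy B f) k = lossy B (geom n f) k.
Proof.
rewrite lossy_coord; induction n as [|n IH]; [simpl; ring |].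
rewrite !geom_S, IH, lossy_coord, !rot_rot, weight_rot, leak_rot.
rewrite (Nat.add_comm n 1); ring.
Qed.

(** The [n]-th term contributes the difference of two consecutive values of
    [ratio k ^ n * f (rot B n k)], up to the common denominator. After a full turn the rotated value
    is [f k] again and the denominator cancels. *)
Lemma geom_telescope n f k : (n <= per B k)%nat ->
  (z * geom n f k - RtoC (1 - leak B k) * geom n f (rot B 1 k))%C =
  ((f k - ratio k ^ n * f (rot B n k)) / (1 - ratio k ^ per B k))%C.
Proof.
intros Hn.
assert (G := ratio_gap k).
assert (Hz := z_neq_0).
assert (Hd : (1 - ratio k ^ per B k)%C <> 0).
{ intros H; rewrite H, Cmult_0_r, Cmod_0 in G; lra. }
induction n as [|n IH].
- change (rot B 0 k) with (rot B (0 * per B k) k); rewrite rot_mul_per.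
  simpl; field; auto.
- rewrite !geom_S, weight_rot, !rot_rot; unfold weight.
  replace (n <? per B k)%nat with true by (symmetry; apply Nat.ltb_lt; lia).
  specialize (IH ltac:(lia)).
  replace (RtoC (1 - leak B k)) with (z * ratio k)%C in *
    by (unfold ratio; field; auto).
  match goal with |- ?a = _ => replace a with
    ((z * geom n f k - z * ratio k * geom n f (rot B 1 k)) +
     (ratio k ^ n * f (rot B n k) - ratio k ^ S n * f (rot B (1 + n) k))
       / (1 - ratio k ^ per B k))%C by (rewrite Cpow_S; field; auto) end.
  rewrite IH; change (1 + n)%nat with (S n); field; auto.
Qed.

Lemma geom_stable n f k : (per B k <= n)%nat -> geom n f k = geom (per B k) f k.
Proof.
induction 1 as [|n Hn IH]; [reflexivity |].
rewrite geom_S, IH; unfold weight.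
replace (n <? per B k)%nat with false by (symmetry; apply Nat.ltb_ge; lia).
ring.
Qed.

Lemma geom_resolvent f k :
  (z * geom (width B) f k - lossy B (geom (width B) f) k)%C = f k.
Proof.
assert (Hw : (per B k <= width B)%nat).
{ apply Nat.divide_pos_le; [apply width_pos | apply cyc_div]. }
rewrite lossy_coord, (geom_stable _ f k Hw).
rewrite (geom_stable _ f (rot B 1 k)), rot_per by (rewrite rot_per; auto).
rewrite geom_telescope by lia.
replace (rot B (per B k) k) with k
  by (rewrite <- (rot_mul_per B 1 k) at 1; f_equal; lia).
assert (G := ratio_gap k); field; intros H.
rewrite H, Cmult_0_r, Cmod_0 in G; lra.
Qed.

(** If [loss g = 1] for [g := (z - lossy)^-1 half], then comparing masses in
    [|g| <= lossy |g| + half] forces [g >= 0], and then [z g = lossy g + half]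
    is positive, so [z = 1]. *)
Lemma loss_geom_half : (1 - loss B (geom (width B) half))%C <> 0.
Proof.
set (g := geom (width B) half); intros H0.
assert (Hg : forall k, (z * g k)%C =
    (RtoC (1 - leak B k) * g (rot B 1 k) + RtoC ((1 / 2) ^ S k))%C).
{ intros k; assert (E := geom_resolvent half k); fold g in E.
  rewrite lossy_coord in E; change (half k) with (RtoC ((1 / 2) ^ S k)) in E.
  rewrite <- E; ring. }
assert (Hloss : loss B g = 1).
{ replace (loss B g) with (1 - (1 - loss B g))%C by ring; rewrite H0; ring. }
assert (HRe : Series (fun k => leak B k * Re (g k)) = 1).
{ rewrite <- Re_loss, Hloss; reflexivity. }
assert (Hmass : l1_norm g <=
    Series (fun k => (1 - leak B k) * Cmod (g (rot B 1 k))) + 1).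
{ assert (Hh : Series (fun k => (1 / 2) ^ S k) = 1)
    by apply is_series_unique, is_series_half.
  apply Rle_trans with (Series (fun k =>
    (1 - leak B k) * Cmod (g (rot B 1 k)) + (1 / 2) ^ S k)).
  2: { rewrite Series_plus, Hh; [lra | apply ex_series_lossy |].
       eexists; apply is_series_half. }
  apply Series_le.
  - intros k; split; [apply Cmod_ge_0 |].
    replace (Cmod (g k)) with (Cmod (z * g k))
      by (rewrite Cmod_mult, z_unit; ring).
    rewrite Hg.
    apply Rle_trans with (1 := Cmod_triangle _ _).
    rewrite Cmod_mult, !Cmod_R; assert (Hl := leak_bounds B k).
    assert (Hk := half_pos k); rewrite !Rabs_pos_eq by lra; lra.
  - apply (@ex_series_plus R_AbsRing R_NormedModule);
      [apply ex_series_lossy | eexists; apply is_series_half]. }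
rewrite lossy_mass in Hmass.
assert (Hex : ex_series (fun k => leak B k * Re (g k))).
{ apply (@ex_series_le R_AbsRing R_CompleteNormedModule _
    (fun k => leak B k * Cmod (g k))); [| apply ex_series_leak_Cmod].
  intros k; change (Rabs (leak B k * Re (g k)) <= leak B k * Cmod (g k)).
  assert (Hl := leak_bounds B k); rewrite Rabs_mult, (Rabs_pos_eq (leak B k)) by lra.
  apply Rmult_le_compat_l; [lra | apply re_le_Cmod]. }
assert (Hpos : forall k, 0 <= leak B k * Cmod (g k) - leak B k * Re (g k)).
{ intros k; assert (Hl := leak_bounds B k); assert (Hr := re_le_Cmod (g k)).
  assert (Hr' := Rle_abs (Re (g k))); nra. }
assert (Hex2 : ex_series (fun k => leak B k * Cmod (g k) - leak B k * Re (g k))).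
{ apply (@ex_series_minus R_AbsRing R_NormedModule); auto.
  apply ex_series_leak_Cmod. }
(* By [Hmass] and [HRe] the terms of [Hpos] have sum at most 0; being nonnegative, each of them
   vanishes, and the leak is positive. *)
assert (Hre : forall k, Re (g k) = Cmod (g k)).
{ intros k.
  assert (H := lsum_le_Series _ (k :: nil) Hpos Hex2
                 ltac:(constructor; [intros [] | constructor])).
  rewrite Series_minus in H; auto; [| apply ex_series_leak_Cmod].
  simpl lsum in H; specialize (Hpos k); rewrite HRe in H.
  assert (Hl := leak_bounds B k); nra. }
assert (Hgr : forall k, g k = RtoC (Cmod (g k))).
{ intros k; assert (H := Cmod2_alt (g k)); rewrite <- Hre in H.
  assert (Him : Im (g k) = 0) by nra.
  rewrite <- Hre; apply injective_projections; [reflexivity | exact Him]. }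
specialize (Hg 0%nat); rewrite (Hgr 0%nat), (Hgr (rot B 1 0)) in Hg.
rewrite <- RtoC_mult, <- RtoC_plus in Hg.
set (r := Cmod (g 0%nat)) in *.
set (s := (1 - leak B 0) * Cmod (g (rot B 1 0)) + (1 / 2) ^ 1) in *.
assert (Hs : 0 < s).
{ assert (Hl := leak_bounds B 0); assert (Hc := Cmod_ge_0 (g (rot B 1 0))).
  unfold s; simpl; nra. }
assert (Hrs : r = s).
{ assert (H := f_equal Cmod Hg); rewrite Cmod_mult, z_unit, !Cmod_R in H.
  rewrite Rmult_1_l, !Rabs_pos_eq in H; auto; [lra | apply Cmod_ge_0]. }
assert (Hz1 : z = 1).
{ rewrite Hrs in Hg.
  assert (Hs0 : RtoC s <> 0) by (intros H; apply RtoC_inj in H; lra).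
  replace z with (z * s / s)%C by (field; auto); rewrite Hg; field; auto. }
(* [z = 1] is a root of unity of every order, against the gap. *)
assert (G := gap 0); rewrite Hz1, Cpow_1_l in G.
replace (1 - 1)%C with (RtoC 0) in G by ring; rewrite Cmod_0 in G; lra.
Qed.

Lemma not_spectrum_chain : ~ spectrum (chain B) z.
Proof.
apply (resolvent_rank_one (lossy B) (chain B) (geom (width B)) (loss B) half).
- apply geom_linear.
- apply loss_linear.
- reflexivity.
- intros x k.
  rewrite (linear_plus _ (geom_linear _)), (linear_scal _ (geom_linear _) z x).
  rewrite (linear_opp _ _ (geom_linear _)).
  change (z * geom (width B) x k + - geom (width B) (lossy B x) k = x k)%C.
  rewrite geom_lossy; apply geom_resolvent.
- apply geom_resolvent.
- apply wcomp_linear.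
- apply loss_geom_half.
Qed.

End Resolvent.

(** * Approximate eigenvectors at points of [U] *)

Lemma Cpow_mod (z : C) n m : (z ^ n)%C = 1 -> (z ^ m)%C = (z ^ (m mod n))%C.
Proof.
intros H; rewrite (Nat.div_mod_eq m n) at 1.
rewrite Cpow_add_r, Cpow_mult_r, H, Cpow_1_l; ring.
Qed.

Lemma Cpow_rot B (z : C) k : (z ^ per B k)%C = 1 ->
  (z ^ rot B 1 k)%C = (z * z ^ k)%C.
Proof.
intros H; unfold rot; rewrite Cpow_add_r, Cpow_mult_r, H, Cpow_1_l.
rewrite <- Cpow_mod, Nat.add_1_r, Cpow_S by auto; ring.
Qed.

(** The character [z ^ k] cut to block [q]: an eigenvector of the undamped rotation once
    [z ^ cyc B q = 1]. *)
Definition block_wave (B : blocks) (z : C) (q k : nat) : C :=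
  if (k / width B =? q)%nat then (z ^ k)%C else 0.

Lemma block_wave_summable B z q : ex_series (fun k => Cmod (block_wave B z q k)).
Proof.
apply (ex_series_incr_n _ (S q * width B)).
apply (ex_series_ext (fun k => Cmod 0)); [| apply summable_zero].
intros k; unfold block_wave.
destruct (Nat.eqb_spec ((S q * width B + k) / width B) q) as [E | _]; auto.
assert (H := width_pos B).
rewrite Nat.div_add_l in E by lia; lia.
Qed.

Definition wave (B : blocks) (z : C) (q : nat) : l1 :=
  mk_l1 (block_wave_summable B z q).

Lemma wave_rot B z q k : (z ^ cyc B q)%C = 1 ->
  wave B z q (rot B 1 k) = (z * wave B z q k)%C.
Proof.
intros H; simpl; unfold block_wave; rewrite rot_div_width.
destruct (Nat.eqb_spec (k / width B) q) as [E | _]; [| ring].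
apply Cpow_rot; unfold per; rewrite E; exact H.
Qed.

Lemma wave_leak B z q k :
  (RtoC (leak B k) * wave B z q k)%C = (RtoC (/ (INR q + 2)) * wave B z q k)%C.
Proof.
simpl; unfold block_wave, leak.
destruct (Nat.eqb_spec (k / width B) q) as [-> | _]; [reflexivity | ring].
Qed.

(** Both the damping and the restored mass carry the leak of block [q] as a factor, so the defect is
    of relative size at most [3 / (q + 2)]. *)
Lemma wave_chain B z q : (z ^ cyc B q)%C = 1 ->
  l1_plus (l1_scal z (wave B z q)) (l1_opp (chain B (wave B z q))) =
  l1_scal (RtoC (/ (INR q + 2)))
    (l1_plus (l1_scal z (wave B z q)) (l1_scal (- csum (wave B z q))%C half)).
Proof.
intros H.
assert (E : loss B (wave B z q) = (RtoC (/ (INR q + 2)) * csum (wave B z q))%C).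
{ change (RtoC (/ (INR q + 2)) * csum (wave B z q))%C
    with (scal (RtoC (/ (INR q + 2)) : C_AbsRing)
      (csum (wave B z q) : AbsRing_NormedModule C_AbsRing)).
  rewrite <- (linear_scal _ csum_linear).
  unfold loss; f_equal; apply l1_ext; intros k; apply wave_leak. }
apply l1_ext; intros k; unfold chain; rewrite E.
match goal with |- ?a = ?b => change a with
  (z * wave B z q k + - (RtoC (1 - leak B k) * wave B z q (rot B 1 k) +
    RtoC (/ (INR q + 2)) * csum (wave B z q) * half k))%C;
  change b with (RtoC (/ (INR q + 2)) *
    (z * wave B z q k + - csum (wave B z q) * half k))%C end.
rewrite wave_rot by exact H; rewrite RtoC_minus.
replace (z * wave B z q k + - ((1 - leak B k) * (z * wave B z q k) +
   RtoC (/ (INR q + 2)) * csum (wave B z q) * half k))%C with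
  (z * (leak B k * wave B z q k) -
   RtoC (/ (INR q + 2)) * csum (wave B z q) * half k)%C by ring.
rewrite wave_leak; ring.
Qed.

Lemma wave_norm_pos B z q : Cmod z = 1 -> 0 < l1_norm (wave B z q).
Proof.
intros Hz; apply Rlt_le_trans with (2 := Cmod_le_l1_norm _ (q * width B)).
simpl; unfold block_wave; rewrite Nat.div_mul, Nat.eqb_refl, Cmod_pow, Hz, pow1.
- lra.
- assert (H := width_pos B); lia.
Qed.

(** An inverse bounded by [M] would give [norm f <= 3 M / (q + 2) * norm f] for waves [f] in
    arbitrarily late blocks. The 3 is 1 for [z f] plus 2 from [csum_bound]. *)
Lemma spectrum_chain B z : Cmod z = 1 ->
  (forall Q, exists q, (Q <= q)%nat /\ (z ^ cyc B q)%C = 1) ->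
  spectrum (chain B) z.
Proof.
intros Hz Hq [S0 [HS [H1 _]]].
destruct (linear_norm S0 HS) as [M [HM Hb]].
destruct (INR_unbounded (3 * M)) as [Q HQ].
destruct (Hq Q) as [q [HQq Hcyc]]; apply le_INR in HQq.
set (f := wave B z q).
assert (Hf := wave_norm_pos B z q Hz); fold f in Hf.
assert (Hd : l1_norm (l1_plus (l1_scal z f) (l1_opp (chain B f))) <=
  / (INR q + 2) * (3 * l1_norm f)).
{ unfold f; rewrite wave_chain by exact Hcyc; fold f.
  assert (Hi : 0 < / (INR q + 2))
    by (apply Rinv_0_lt_compat; assert (H := pos_INR q); lra).
  rewrite l1_norm_scal, Cmod_R, Rabs_pos_eq by lra.
  apply Rmult_le_compat_l; [lra |].
  apply Rle_trans with (1 := l1_norm_triangle _ _).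
  rewrite !l1_norm_scal, Hz, Cmod_opp, half_norm.
  assert (H := csum_bound f); lra. }
specialize (Hb (l1_plus (l1_scal z f) (l1_opp (chain B f)))).
change (S0 (l1_plus (l1_scal z f) (l1_opp (chain B f))))
  with (S0 (minus (scal z f) (chain B f))) in Hb.
rewrite H1 in Hb.
change (l1_norm f <= M * l1_norm (l1_plus (l1_scal z f) (l1_opp (chain B f)))) in Hb.
assert (Hq2 : 0 < INR q + 2) by (assert (H := pos_INR q); lra).
assert (H : l1_norm f <= M * (/ (INR q + 2) * (3 * l1_norm f))).
{ apply Rle_trans with (1 := Hb), Rmult_le_compat_l; [lra | exact Hd]. }
apply (Rmult_le_compat_l (INR q + 2)) in H; [| lra].
replace ((INR q + 2) * (M * (/ (INR q + 2) * (3 * l1_norm f))))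
  with (3 * M * l1_norm f) in H by (field; lra).
nra.
Qed.

(** * Choice of the cycle lengths and conclusion *)

Lemma In_divide_prod ds d : In d ds -> Nat.divide d (fold_right Nat.mul 1%nat ds).
Proof.
induction ds as [|x ds IH]; simpl; [tauto |]; intros [-> | H].
- apply Nat.divide_factor_l.
- apply Nat.divide_mul_r; auto.
Qed.

Lemma prod_pos ds : List.Forall (lt 0) ds -> (0 < fold_right Nat.mul 1%nat ds)%nat.
Proof. induction 1; simpl; lia. Qed.

Lemma nth_mod_In (ds : list nat) q : ds <> nil -> In (nth (q mod length ds) ds 0%nat) ds.
Proof.
intros H; apply nth_In, Nat.mod_upper_bound; destruct ds; simpl; [tauto | lia].
Qed.

(** Running through [ds] periodically makes every length recur infinitely often; the product of [ds]
    is a common multiple. *)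
Definition list_blocks (ds : list nat) (H0 : ds <> nil)
  (Hp : List.Forall (lt 0) ds) : blocks := {|
  width := fold_right Nat.mul 1%nat ds;
  cyc q := nth (q mod length ds) ds 0%nat;
  width_pos := prod_pos ds Hp;
  cyc_div q := In_divide_prod ds _ (nth_mod_In ds q H0)
|}.

Lemma roots_gap (z : C) (ds : list nat) :
  (forall d, In d ds -> (z ^ d)%C <> 1) ->
  exists c, 0 < c /\ forall d, In d ds -> c <= Cmod (z ^ d - 1)%C.
Proof.
induction ds as [|d ds IH]; intros H.
- exists 1; split; [lra | intros d []].
- destruct IH as [c [Hc Hg]]; [intros; apply H; right; auto |].
  assert (Hd : 0 < Cmod (z ^ d - 1)).
  { apply Cmod_gt_0; intros E; apply (H d); [left; auto |].
    replace (z ^ d)%C with (z ^ d - 1 + 1)%C by ring; rewrite E; ring. }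
  exists (Rmin c (Cmod (z ^ d - 1))); split; [apply Rmin_glb_lt; auto |].
  intros d' [<- | Hd']; [apply Rmin_r |].
  apply Rle_trans with (1 := Rmin_l _ _); auto.
Qed.

Theorem theorem1p1 :
  forall U : C -> Prop,
    (exists z, U z) ->
    finite_union_of_finite_circle_subgroups U ->
    exists T : l1 -> l1,
      stochastic T /\ irreducible T /\
      (forall z : C, peripheral_spectrum T z <-> U z).
Proof.
intros U Hne HU.
destruct (finite_union_roots U Hne HU) as [ds [H0 [Hp HUd]]].
set (B := list_blocks ds H0 Hp).
exists (chain B); split; [apply chain_stochastic |].
split; [apply chain_irreducible |].
intros z; split.
- intros [Hs Hz]; apply NNPP; intros HUz.
  destruct (roots_gap z ds) as [c [Hc Hg]].
  { intros d Hd E; apply HUz, HUd; exists d; auto. }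
  apply (not_spectrum_chain B z c); auto.
  intros k; apply Hg, nth_mod_In, H0.
- intros HUz; assert (Hz : Cmod z = 1).
  { destruct HU as [Gs [HG HUG]]; apply HUG, Exists_exists in HUz.
    destruct HUz as [G [HinG HGz]]; rewrite List.Forall_forall in HG.
    apply (proj1 (HG G HinG)), HGz. }
  split; [| exact Hz]; apply spectrum_chain; auto.
  apply HUd in HUz; destruct HUz as [d [Hd E]]; intros Q.
  destruct (In_nth ds d 0%nat Hd) as [i [Hi Ei]].
  (* The [Q]-th recurrence of position [i]; this index is at least [Q] because [ds] is nonempty. *)
  exists (i + Q * length ds)%nat; split; [nia |].
  change (cyc B (i + Q * length ds))
    with (nth ((i + Q * length ds) mod length ds) ds 0%nat).
  rewrite Nat.Div0.mod_add, Nat.mod_small, Ei by auto; exact E.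
Qed.
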